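(* If $P_\infty$ is the two-way infinite path, then $\mathrm{mob}(P_\infty\,\square\, P_\infty)=4$.
   Context: $P_\infty$ has vertex set $\mathbb{Z}$ with $i\sim i+1$; $P_\infty\,\square\,P_\infty$ is the infinite grid on $\mathbb{Z}^2$ (Cartesian product). A set $S$ of vertices is a general position set if no three vertices of $S$ lie on a common shortest path. Robots are placed one per vertex of a general position set $S$; a move $u\to v$ along an edge $uv$ with $u\in S$ is legal if $v\notin S$ and $(S\setminus\{u\})\cup\{v\}$ is a general position set. $S$ is a mobile general position set if there is a (possibly infinite) sequence of legal moves starting from $S$ such that every vertex is visited at least once by some robot; $\mathrm{mob}(G)$ is the maximum size of a mobile general position set. *)

(* Defs.v *)
From HB Require Import structures.
From mathcomp Require Import all_boot all_order all_algebra.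
From mathcomp Require Import boolp classical_sets functions cardinality.

Set Implicit Arguments.
Unset Strict Implicit.
Unset Printing Implicit Defensive.

Import Order.TTheory GRing.Theory Num.Theory.

Local Open Scope classical_set_scope.
Local Open Scope card_scope.

Record sgraph := SGraph {
  vertex :> choiceType;
  adj : rel vertex;
  adj_sym : symmetric adj;
  adj_irr : irreflexive adj }.

Section GeneralPosition.
Variable G : sgraph.
Implicit Types S T : set G.

(* As with [path], the pair [x], [p] stands for the vertex sequence [x :: p],
   from [x] to [last x p], with [size p] edges. *)
Definition gpath (x : G) (p : seq G) : bool :=
  path (@adj G) x p && uniq (x :: p).

Definition shortest_path (x : G) (p : seq G) : Prop :=
  gpath x p /\
  forall q : seq G, gpath x q -> last x q = last x p -> size p <= size q.

Definition general_position S : Prop :=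
  forall u v w : G, S u -> S v -> S w ->
    u <> v -> u <> w -> v <> w ->
    ~ exists (x : G) (p : seq G),
        [/\ shortest_path x p, u \in x :: p, v \in x :: p & w \in x :: p].

Definition legal_move S T : Prop :=
  exists u v : G,
    [/\ S u, adj u v, ~ S v,
        T = (S `\` [set u]) `|` [set v] & general_position T].

(* [N] is the number of moves, [None] meaning infinitely many. *)
Definition mobile_general_position S : Prop :=
  general_position S /\
  exists (N : option nat) (s : nat -> set G),
    let within n := if N is Some m then n <= m else true in
    [/\ s 0 = S,
        forall n, within n.+1 -> legal_move (s n) (s n.+1)
      & forall x : G, exists2 n, within n & s n x].

(* [n] is the maximum size of a mobile general position set; the sets range
   over all subsets of the vertex set, infinite ones included. *)
Definition is_mob (n : nat) : Prop :=
  (exists2 S : set G, mobile_general_position S & S #= `I_n) /\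
  (forall S : set G, mobile_general_position S -> S #<= `I_n).

End GeneralPosition.

Section CartesianProduct.
Variables G H : sgraph.

Definition cartesian_adj : rel (G * H)%type := fun x y =>
  (x.1 == y.1) && adj x.2 y.2 || (x.2 == y.2) && adj x.1 y.1.

Lemma cartesian_adj_sym : symmetric cartesian_adj.
Proof.
move=> x y; rewrite /cartesian_adj (eq_sym x.1) (eq_sym x.2).
by rewrite (adj_sym x.1) (adj_sym x.2).
Qed.

Lemma cartesian_adj_irr : irreflexive cartesian_adj.
Proof. by move=> x; rewrite /cartesian_adj !adj_irr !andbF. Qed.

Definition cartesian_product : sgraph :=
  SGraph cartesian_adj_sym cartesian_adj_irr.

End CartesianProduct.

Definition P_infty_adj : rel int := fun i j =>
  ((j == i + 1) || (i == j + 1))%R.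

Lemma P_infty_adj_sym : symmetric P_infty_adj.
Proof. by move=> i j; rewrite /P_infty_adj orbC. Qed.

Lemma P_infty_adj_irr : irreflexive P_infty_adj.
Proof.
by move=> i; rewrite /P_infty_adj orbb -[X in X == _]addr0 (inj_eq (addrI i)).
Qed.

Definition P_infty : sgraph := SGraph P_infty_adj_sym P_infty_adj_irr.

(* Main.v *)
(** In the grid three vertices lie on a common shortest path iff one of them
    lies in the bounding box of the other two. Hence a
    general position set has at most four elements: among five points sorted by
    abscissa, three have monotone ordinates (Erdos-Szekeres). Conversely, four
    points, each strictly extreme in its own compass direction, are always in
    general position. A unit diamond keeps this shape while its robots step
    right one after the other, in the order east, north, south, west, and
    likewise for the other directions, so it can be translated anywhere;
    visiting an enumeration of the plane one vertex after the other yields the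
    infinite sequence of moves. *)

From mathcomp Require Import all_boot all_order all_algebra finmap zify.
From mathcomp Require Import boolp classical_sets functions cardinality.
Require Import Defs.

Set Implicit Arguments.
Unset Strict Implicit.
Unset Printing Implicit Defensive.

Import Order.TTheory GRing.Theory Num.Theory.

Local Open Scope classical_set_scope.
Local Open Scope card_scope.

(** * Infinite sequences that meet countably many targets *)

Section CoveringSequence.
Variables (T : Type) (e : rel T) (I : T -> Prop) (hit : nat -> T -> Prop).
Hypothesis hit_reachable : forall x k, I x ->
  exists p, [/\ path e x p, 0 < size p, I (last x p) & hit k (last x p)].

(** Finite paths, one for each target and each ending in [I], are chained. Every stage is a prefix
    of the later ones, so the stages have a limit. *)
Lemma covering_sequence x0 : I x0 ->
  exists s : nat -> T, [/\ s 0 = x0, forall n, e (s n) (s n.+1)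
    & forall k, exists n, hit k (s n)].
Proof.
move=> Ix0.
have /choice[f fP] : forall xk : T * nat, exists p, I xk.1 ->
    [/\ path e xk.1 p, 0 < size p, I (last xk.1 p) & hit xk.2 (last xk.1 p)].
  move=> [x k]; have [/(hit_reachable k)[p pP]|nIx] := pselect (I x).
    by exists p.
  by exists [::].
pose L := fix L k :=
  if k is k'.+1 then L k' ++ f (last x0 (L k'), k') else [::].
have LP k : [/\ path e x0 (L k), k <= size (L k) & I (last x0 (L k))].
  elim: k => [|k [pL sL IL]] //=.
  have [/= pf sf If _] := fP (last x0 (L k), k) IL.
  by rewrite cat_path pL pf size_cat last_cat; split=> //; lia.
have L_prefix m k : exists q, L (k + m) = L k ++ q.
  elim: m => [|m [q Lq]]; first by exists [::]; rewrite addn0 cats0.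
  by rewrite addnS /= Lq -catA; eexists.
have nth_L n k : n <= size (L k) -> nth x0 (x0 :: L k) n = nth x0 (x0 :: L n) n.
  move=> nk; have [_ nn _] := LP n.
  have [kn|nk'] := leqP k n.
    have [q] := L_prefix (n - k) k; rewrite subnKC // => ->.
    by rewrite -cat_cons nth_cat /= ltnS nk.
  have [q] := L_prefix (k - n) n; rewrite subnKC 1?ltnW // => ->.
  by rewrite -cat_cons nth_cat /= ltnS nn.
(* Each piece is nonempty, so [L n] has at least [n] steps and already determines term [n]. *)
exists (fun n => nth x0 (x0 :: L n) n); split=> // [n|k].
  have [/(pathP x0)/(_ n) eL sL _] := LP n.+1.
  by have := eL sL; rewrite (nth_L n n.+1) // ltnW.
exists (size (L k.+1)); rewrite -(nth_L _ k.+1) // -last_nth /= last_cat.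
by have [_ _ /(fP (_, k))[]] := LP k.
Qed.

End CoveringSequence.

(** An infinite set has a finite subset with more than [n] elements, so bounding the duplicate-free
    lists excludes infinite sets too. *)
Lemma card_le_uniqP (T : choiceType) (S : set T) n :
  (forall s : seq T, uniq s -> (forall x, x \in s -> S x) -> size s <= n) ->
  S #<= `I_n.
Proof.
move=> S_le; have [/finite_fsetP[X SX]|/(infinite_set_fset n.+1)[B BS nB]] :=
  pselect (finite_set S).
  rewrite {}SX in S_le *.
  have /card_eq_fsetP/card_eqPle[] : #|` X| = #|` X| by [].
  by move=> /card_le_trans XI _; apply: XI; rewrite card_le_II; apply: S_le.
have := S_le (enum_fset B) (fset_uniq B) BS.
by rewrite leqNgt nB.
Qed.

(** * Shortest paths described by a distance function *)

Section Geodesics.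
Variables (G : sgraph) (dist : G -> G -> nat).
Hypothesis distxx : forall x, dist x x = 0.
Hypothesis dist_eq0 : forall x y, dist x y = 0 -> x = y.
Hypothesis dist_triangle : forall y x z, dist x z <= dist x y + dist y z.
Hypothesis adj_dist : forall x y, adj x y -> dist x y = 1.
Hypothesis dist_step : forall x y, dist x y != 0 ->
  exists2 z, adj x z & dist x y = (dist z y).+1.

Lemma dist_path x p : path (@adj G) x p ->
  dist x (last x p) <= size p.
Proof.
elim: p x => [|y p IHp] x /=; first by rewrite distxx.
case/andP=> /adj_dist xy /IHp.
by have := dist_triangle y x (last y p); lia.
Qed.

Lemma geodesic x y :
  exists p, [/\ path (@adj G) x p, last x p = y & size p = dist x y].
Proof.
have [n] := ubnP (dist x y); elim: n x => // n IHn x dn.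
have [/dist_eq0->|d_neq0] := eqVneq (dist x y) 0.
  by exists [::]; rewrite distxx.
have [z xz zy] := dist_step d_neq0.
have [|p [pp lp sp]] := IHn z; first by rewrite zy in dn.
by exists (z :: p); rewrite /= xz pp sp zy.
Qed.

(** Deleting the loops of [p] leaves a path with the same ends, hence no shorter than the distance,
    which is [size p]: nothing was deleted. *)
Lemma gpath_geodesic x p :
  path (@adj G) x p -> size p = dist x (last x p) -> gpath x p.
Proof.
move=> pp sp; rewrite /gpath pp.
move: sp; case: (shortenP pp) => q pq uq sqp sp.
apply: (@leq_size_uniq _ (x :: q)) => //= [z|].
  by rewrite !inE => /orP[->|/sqp->//]; rewrite ?orbT.
by rewrite ltnS sp dist_path.
Qed.

Lemma shortest_distP x p : shortest_path x p <->
  path (@adj G) x p /\ size p = dist x (last x p).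
Proof.
split=> [[/andP[pp _] p_min]|[pp sp]].
  split=> //; apply/eqP; rewrite eqn_leq dist_path // andbT.
  have [q [pq lq sq]] := geodesic x (last x p).
  by rewrite -sq p_min // gpath_geodesic ?lq.
split; first exact: gpath_geodesic.
by move=> q /andP[pq _] lq; rewrite sp -lq dist_path.
Qed.

Lemma dist_path_nth x p i j : path (@adj G) x p ->
  i <= j <= size p -> dist (nth x (x :: p) i) (nth x (x :: p) j) <= j - i.
Proof.
move=> /(pathP x) pp /andP[ij jp].
have -> : j = i + (j - i) by lia.
have: i + (j - i) <= size p by lia.
elim: (j - i) => [|m IHm] imp; first by rewrite addn0 distxx.
have step : dist (nth x (x :: p) (i + m)) (nth x (x :: p) (i + m).+1) = 1.
  by apply: adj_dist; apply: pp; lia.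
have := dist_triangle (nth x (x :: p) (i + m))
  (nth x (x :: p) i) (nth x (x :: p) (i + m).+1).
by have := IHm; rewrite addnS; lia.
Qed.

(** The indices cut the path into four segments, each at least as long as the distance of its ends.
    The lengths add up to the distance of the ends of the path, so no triangle inequality along it
    can be strict. *)
Lemma shortest_between x p i j k : shortest_path x p ->
  i <= j <= k -> k <= size p ->
  dist (nth x (x :: p) i) (nth x (x :: p) j) +
  dist (nth x (x :: p) j) (nth x (x :: p) k) =
  dist (nth x (x :: p) i) (nth x (x :: p) k).
Proof.
move=> /shortest_distP[pp sp] ijk kp.
pose a := nth x (x :: p); rewrite -/(a i) -/(a j) -/(a k).
have ai : dist x (a i) <= i.
  by have := @dist_path_nth x p 0 i pp; rewrite -/(a i) /=; lia.
have aij : dist (a i) (a j) <= j - i by apply: dist_path_nth pp _; lia.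
have ajk : dist (a j) (a k) <= k - j by apply: dist_path_nth pp _; lia.
have ak : dist (a k) (last x p) <= size p - k.
  by rewrite (last_nth x); apply: dist_path_nth pp _; lia.
have := dist_triangle (a i) x (last x p).
have := dist_triangle (a k) (a i) (last x p).
have := dist_triangle (a j) (a i) (a k).
lia.
Qed.

Lemma general_position_distP (S : set G) : general_position S <->
  forall u v w, S u -> S v -> S w -> u <> v -> u <> w -> v <> w ->
    dist u v + dist v w <> dist u w.
Proof.
split=> gpS u v w Su Sv Sw uv uw vw.
  move=> d_uvw; apply: (gpS u v w) => //.
  have [p [pp lp sp]] := geodesic u v.
  have [q [pq lq sq]] := geodesic v w.
  exists u, (p ++ q); split; last 2 first.
  - by rewrite -cat_cons mem_cat -lp mem_last.
  - have := mem_last v q; rewrite lq !inE mem_cat => /orP[/eqP wv|->].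
      by rewrite wv in vw.
    by rewrite !orbT.
  - apply/shortest_distP.
    by rewrite cat_path last_cat size_cat lp pp pq lq; split=> //; lia.
  - exact: mem_head.
move=> [x [p [sp]]] /(nthP x)[i ip iu] /(nthP x)[j jp jv] /(nthP x)[k kp kw].
have between := shortest_between sp.
(* The roles of [u] and [w] are symmetric. Whichever vertex then has the middle index lies
   metrically between the other two. *)
wlog ik : u w i k Su Sw uv uw vw ip kp iu kw / i <= k.
  move=> W; have [ik|/ltnW ki] := leqP i k; first exact: (W u w i k).
  by apply: (W w u k i) => //; apply: nesym.
rewrite /= !ltnS in ip jp kp.
have [ij|ji] := leqP i j; last first.
  apply: (gpS v u w) => //; first exact: nesym.
  by rewrite -iu -jv -kw; apply: between; lia.
have [jk|kj] := leqP j k.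
  by apply: (gpS u v w) => //; rewrite -iu -jv -kw; apply: between; lia.
apply: (gpS u w v) => //; first exact: nesym.
by rewrite -iu -jv -kw; apply: between; lia.
Qed.

End Geodesics.

Lemma card_uniq_set (T : choiceType) (s : seq T) :
  uniq s -> [set` s] #= `I_(size s).
Proof.
move=> us; have -> : [set` s] = [set` seq_fset tt s].
  by apply/seteqP; split=> x; rewrite /mkset (seq_fsetE tt s x).
by apply/card_eq_fsetP; rewrite size_seq_fset undup_id.
Qed.

(** * The taxicab metric of the grid and the upper bound four *)

Notation grid := (cartesian_product P_infty P_infty).

(** The projections are typed in [int], so that integer order and arithmetic apply to
    coordinates. *)
Definition gx (z : grid) : int := z.1.
Definition gy (z : grid) : int := z.2.

Definition gdist (x y : grid) : nat :=
  `|(gx x - gx y)%R|%N + `|(gy x - gy y)%R|%N.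

Lemma grid_adjE (x y : grid) : adj x y = (gdist x y == 1).
Proof.
move: x y => [a b] [c d]; rewrite /adj /= /cartesian_adj /gdist /gx /gy /=.
rewrite /adj /= /P_infty_adj; lia.
Qed.

Lemma gdist_triangle (y x z : grid) : gdist x z <= gdist x y + gdist y z.
Proof. rewrite /gdist; lia. Qed.

Lemma gdist_eq0 (x y : grid) : gdist x y = 0 -> x = y.
Proof.
by move: x y => [a b] [c d]; rewrite /gdist /gx /gy /= => d0; congr pair; lia.
Qed.

Lemma gdistxx (x : grid) : gdist x x = 0.
Proof. rewrite /gdist; lia. Qed.

Lemma gdist_step (x y : grid) : gdist x y != 0 ->
  exists2 z : grid, adj x z & gdist x y = (gdist z y).+1.
Proof.
move=> d_neq0.
have [z xz zy] : exists2 z : grid, gdist x z = 1 & gdist x y = (gdist z y).+1.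
  move: x y d_neq0 => [a b] [c d]; rewrite /gdist /gx /gy /= => d_neq0.
  have [ac|ac|ac] := ltgtP a c.
  - by exists (a + 1, b)%R => /=; lia.
  - by exists (a - 1, b)%R => /=; lia.
  have [bd|bd|bd] := ltgtP b d.
  - by exists (a, b + 1)%R => /=; lia.
  - by exists (a, b - 1)%R => /=; lia.
  by lia.
by exists z; rewrite // grid_adjE xz.
Qed.

Lemma general_position_gridP (S : set grid) : general_position S <->
  forall u v w, S u -> S v -> S w -> u <> v -> u <> w -> v <> w ->
    gdist u v + gdist v w <> gdist u w.
Proof.
apply: general_position_distP.
- exact: gdistxx.
- exact: gdist_eq0.
- exact: gdist_triangle.
- by move=> x y; rewrite grid_adjE => /eqP.
- exact: gdist_step.
Qed.

(** The boolean equation covers two cases: the ordinates rise weakly twice or fall strictly twice.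
    Either way [v] is in the bounding box of [u] and [w]. *)
Lemma gdist_monotone (u v w : grid) :
  (gx u <= gx v)%R -> (gx v <= gx w)%R ->
  (gy u <= gy v)%R = (gy v <= gy w)%R ->
  gdist u v + gdist v w = gdist u w.
Proof. rewrite /gdist; lia. Qed.

Lemma general_position_grid_size (S : set grid) (s : seq grid) :
  general_position S -> uniq s -> (forall x, x \in s -> S x) -> size s <= 4.
Proof.
move=> /general_position_gridP gpS us sS; rewrite leqNgt; apply/negP => s5.
pose le1 : rel grid := fun x y => (gx x <= gx y)%R.
have le1_total : total le1 by move=> x y; rewrite /le1; lia.
have le1_trans : transitive le1 by move=> x y z; rewrite /le1; lia.
pose o : grid := (0, 0)%R; pose t := sort le1 s.
have tS x : x \in t -> S x by rewrite mem_sort => /sS.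
have : uniq t by rewrite sort_uniq.
have : 4 < size t by rewrite size_sort.
have : sorted le1 t by apply: sort_sorted.
rewrite (sorted_pairwise le1_trans) => /(pairwiseP o) t_le t5 ut.
pose y i := gy (nth o t i).
(* Abscissae are sorted, so two equal comparisons of ordinates would put the middle point between
   the others by [gdist_monotone]. *)
have alt i j k : i < j < k -> k < 5 -> (y i <= y j)%R != (y j <= y k)%R.
  move=> /andP[ij jk] k5.
  have [it jt kt] : [/\ i < size t, j < size t & k < size t] by split; lia.
  have t_neq m n : m < size t -> n < size t -> m < n ->
      nth o t m <> nth o t n.
    by move=> mt nt mn /eqP; rewrite nth_uniq // ltn_eqF.
  apply/negP => /eqP y_mono.
  apply: (gpS (nth o t i) (nth o t j) (nth o t k)).
  - exact/tS/mem_nth.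
  - exact/tS/mem_nth.
  - exact/tS/mem_nth.
  - exact: t_neq.
  - exact: t_neq (ltn_trans ij jk).
  - exact: t_neq.
  - by apply: gdist_monotone => //; apply: t_le.
(* Under the constraint [alt] the comparisons 01, 13, 34, 23, 12 form a cycle
   of odd length. *)
have := alt 0 1 3 isT isT; have := alt 1 3 4 isT isT.
have := alt 2 3 4 isT isT; have := alt 1 2 3 isT isT.
have := alt 0 1 2 isT isT.
by do 5!case: (_ <= _)%R.
Qed.

(** * Four extreme robots and their reversible moves *)

Definition robots (w n e s : grid) : set grid := [set` [:: w; n; e; s]].

(* Each robot is strictly extreme in its own compass direction. *)
Definition compass (w n e s : grid) : bool :=
  [&& all (fun z : grid => (gx w < gx z)%R) [:: n; e; s],
      all (fun z : grid => (gy z < gy n)%R) [:: w; e; s],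
      all (fun z : grid => (gx z < gx e)%R) [:: w; n; s]
    & all (fun z : grid => (gy s < gy z)%R) [:: w; n; e]].

(** A point in the bounding box of two others is strictly extreme in no direction, whereas every
    robot is in one. *)
Lemma compass_general_position w n e s :
  compass w n e s -> general_position (robots w n e s).
Proof.
rewrite /compass /= => c.
apply/general_position_gridP => u v z Su Sv Sz uv uz vz d_uvz.
(* Equality in the taxicab triangle inequality forces betweenness in each coordinate. *)
have [b1 b2] : (gx u <= gx v <= gx z \/
                 gx z <= gx v <= gx u)%R /\
                (gy u <= gy v <= gy z \/
                 gy z <= gy v <= gy u)%R.
  by move: d_uvz; rewrite /gdist; lia.
move: Su Sv Sz; rewrite /robots /= !inE.
by move=> /or4P[] /eqP ? /or4P[] /eqP ? /or4P[] /eqP ?; subst=> //; lia.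
Qed.

Lemma compass_uniq w n e s : compass w n e s -> uniq [:: w; n; e; s].
Proof.
rewrite /compass /= !inE !negb_or !andbT => c.
by do ![apply/andP; split]; apply/eqP => zz; subst; lia.
Qed.

(** Without duplicates, replacing one list entry agrees with removing [u] from the set and adding
    [v]. *)
Lemma legal_move_replace (G : sgraph) (l1 l2 : seq G) u v :
  adj u v -> uniq (l1 ++ u :: l2) -> uniq (l1 ++ v :: l2) ->
  general_position [set` l1 ++ v :: l2] ->
  legal_move [set` l1 ++ u :: l2] [set` l1 ++ v :: l2].
Proof.
rewrite (uniq_catC l1 (u :: _)) (uniq_catC l1 (v :: _)) /= !mem_cat => uv.
move=> /andP[/norP[nu2 nu1] _] /andP[/norP[nv2 nv1] _] gpv.
exists u, v; split=> //=.
- by rewrite mem_cat mem_head orbT.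
- rewrite mem_cat inE (negbTE nv1) (negbTE nv2) orbF => /eqP vu.
  by rewrite vu adj_irr in uv.
apply/seteqP; split=> z /=; rewrite !mem_cat !inE.
  rewrite orbCA => /orP[/eqP->|zl]; [by right | left].
  split; first by rewrite orbCA zl orbT.
  by move=> zu; rewrite zu (negbTE nu1) (negbTE nu2) in zl.
case=> [[zl /eqP/negbTE zu]|-> /=]; last by rewrite eqxx orbT.
by move: zl; rewrite zu /= => /orP[->//|->]; rewrite !orbT.
Qed.

(** At least one move is demanded, as [covering_sequence] needs nonempty paths. *)
Definition reach (G : sgraph) (S T : set G) : Prop :=
  exists p, [/\ path (fun S T => `[<legal_move S T>]) S p, 0 < size p
               & last S p = T].

Lemma legal_move_reach (G : sgraph) (S T : set G) :
  legal_move S T -> reach S T.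
Proof.
by move=> ST; exists [:: T]; split=> //=; rewrite andbT; apply/asboolP.
Qed.

Lemma reach_trans (G : sgraph) (T S U : set G) :
  reach S T -> reach T U -> reach S U.
Proof.
move=> [p [pp sp <-]] [q [pq sq <-]]; exists (p ++ q).
by rewrite cat_path pp pq size_cat last_cat; split=> //; lia.
Qed.

(** Moves between general position sets can be undone, so with this symmetric relation only the
    steps right and up need checking. *)
Definition interreach (G : sgraph) (S T : set G) : Prop :=
  reach S T /\ reach T S.

Lemma interreach_sym (G : sgraph) (S T : set G) :
  interreach S T -> interreach T S.
Proof. by case. Qed.

Lemma interreach_trans (G : sgraph) (T S U : set G) :
  interreach S T -> interreach T U -> interreach S U.
Proof.
move=> [ST TS] [TU UT]; split.
  exact: reach_trans TU.
exact: reach_trans TS.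
Qed.

Lemma interreach_replace (G : sgraph) (l1 l2 : seq G) u v :
  adj u v -> uniq (l1 ++ u :: l2) -> uniq (l1 ++ v :: l2) ->
  general_position [set` l1 ++ u :: l2] ->
  general_position [set` l1 ++ v :: l2] ->
  interreach [set` l1 ++ u :: l2] [set` l1 ++ v :: l2].
Proof.
move=> uv uu uv' gu gv; split; apply/legal_move_reach/legal_move_replace => //.
by rewrite adj_sym.
Qed.

Section RobotMoves.
Variables w n e s : grid.
Hypothesis c : compass w n e s.

Lemma move_west w' : compass w' n e s -> adj w w' ->
  interreach (robots w n e s) (robots w' n e s).
Proof.
move=> c' a; apply: (@interreach_replace grid [::] [:: n; e; s]) => //.
- exact: compass_uniq c.
- exact: compass_uniq c'.
- exact: compass_general_position c.
- exact: compass_general_position c'.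
Qed.

Lemma move_north n' : compass w n' e s -> adj n n' ->
  interreach (robots w n e s) (robots w n' e s).
Proof.
move=> c' a; apply: (@interreach_replace grid [:: w] [:: e; s]) => //.
- exact: compass_uniq c.
- exact: compass_uniq c'.
- exact: compass_general_position c.
- exact: compass_general_position c'.
Qed.

Lemma move_east e' : compass w n e' s -> adj e e' ->
  interreach (robots w n e s) (robots w n e' s).
Proof.
move=> c' a; apply: (@interreach_replace grid [:: w; n] [:: s]) => //.
- exact: compass_uniq c.
- exact: compass_uniq c'.
- exact: compass_general_position c.
- exact: compass_general_position c'.
Qed.

Lemma move_south s' : compass w n e s' -> adj s s' ->
  interreach (robots w n e s) (robots w n e s').
Proof.
move=> c' a; apply: (@interreach_replace grid [:: w; n; e] [::]) => //.
- exact: compass_uniq c.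
- exact: compass_uniq c'.
- exact: compass_general_position c.
- exact: compass_general_position c'.
Qed.

End RobotMoves.

(** * Translating the unit diamond over the plane *)

Definition diamond (x y : int) : set grid :=
  robots (x - 1, y)%R (x, y + 1)%R (x + 1, y)%R (x, y - 1)%R.

Lemma diamond_right x y : interreach (diamond x y) (diamond (x + 1)%R y).
Proof.
have -> : diamond (x + 1)%R y =
    robots (x, y)%R (x + 1, y + 1)%R (x + 2, y)%R (x + 1, y - 1)%R.
  by rewrite /diamond; do !congr robots; congr pair; lia.
(* The leading robot goes first and the trailing one last: north and south may enter column [x + 1]
   only after east has left it, and west may enter column [x] only after both have left that. *)
apply: interreach_trans (move_east (e' := (x + 2, y)%R) _ _ _) _;
  rewrite ?grid_adjE /gdist /compass /gx /gy /=; try lia.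
apply: interreach_trans (move_north (n' := (x + 1, y + 1)%R) _ _ _) _;
  rewrite ?grid_adjE /gdist /compass /gx /gy /=; try lia.
apply: interreach_trans (move_south (s' := (x + 1, y - 1)%R) _ _ _) _;
  rewrite ?grid_adjE /gdist /compass /gx /gy /=; try lia.
by apply: move_west; rewrite ?grid_adjE /gdist /compass /gx /gy /=; lia.
Qed.

Lemma diamond_up x y : interreach (diamond x y) (diamond x (y + 1)%R).
Proof.
have -> : diamond x (y + 1)%R =
    robots (x - 1, y + 1)%R (x, y + 2)%R (x + 1, y + 1)%R (x, y)%R.
  by rewrite /diamond; do !congr robots; congr pair; lia.
apply: interreach_trans (move_north (n' := (x, y + 2)%R) _ _ _) _;
  rewrite ?grid_adjE /gdist /compass /gx /gy /=; try lia.
apply: interreach_trans (move_west (w' := (x - 1, y + 1)%R) _ _ _) _;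
  rewrite ?grid_adjE /gdist /compass /gx /gy /=; try lia.
apply: interreach_trans (move_east (e' := (x + 1, y + 1)%R) _ _ _) _;
  rewrite ?grid_adjE /gdist /compass /gx /gy /=; try lia.
by apply: move_south; rewrite ?grid_adjE /gdist /compass /gx /gy /=; lia.
Qed.

Lemma interreach_int (G : sgraph) (F : int -> set G) :
  (forall i, interreach (F i) (F (i + 1)%R)) ->
  forall i j, interreach (F i) (F j).
Proof.
move=> F_step.
have F_nat i (m : nat) : interreach (F i) (F (i + m%:Z)%R).
  elim: m => [|m IHm]; last first.
    by apply: interreach_trans IHm _; rewrite -addn1 PoszD addrA; apply: F_step.
  (* Staying put is not a nonempty path, so for [m = 0] one goes to [F (i + 1)] and back. *)
  by rewrite addr0; apply: interreach_trans (F_step i) (interreach_sym _).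
move=> i j; have [ij|ji] := leP i j.
  by have := F_nat i `|(j - i)%R|%N; rewrite (_ : i + _ = j)%R //; lia.
apply: interreach_sym.
by have := F_nat j `|(i - j)%R|%N; rewrite (_ : j + _ = i)%R //; lia.
Qed.

Lemma diamond_reach x y x' y' : reach (diamond x y) (diamond x' y').
Proof.
have [] // : interreach (diamond x y) (diamond x' y').
apply: (interreach_trans (T := diamond x' y)).
  by apply: (interreach_int (F := diamond^~ y)) => i; apply: diamond_right.
by apply: interreach_int => i; apply: diamond_up.
Qed.

Lemma diamond_compass x y :
  compass (x - 1, y)%R (x, y + 1)%R (x + 1, y)%R (x, y - 1)%R.
Proof. rewrite /compass /gx /gy /=; lia. Qed.

Lemma mobile_diamond x y : mobile_general_position (diamond x y).
Proof.
split; first exact/compass_general_position/diamond_compass.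
(* Vertices are enumerated by [unpickle]. A code of no vertex imposes nothing, so the default value
   of [z] below is harmless. *)
pose hit k (S : set grid) :=
  forall z : int * int, choice.unpickle k = Some z -> S (z : grid).
pose e (S T : set grid) := `[<legal_move S T>].
pose I (S : set grid) := exists a b, S = diamond a b.
have hit_reachable S k : I S ->
    exists p, [/\ path e S p, 0 < size p, I (last S p) & hit k (last S p)].
  move=> [a [b ->]].
  pose z : int * int := odflt (0, 0)%R (choice.unpickle k).
  (* The centre of a diamond is empty; centring it one step right of [z] puts the west robot on
     [z]. *)
  have [p [pp sp lp]] := diamond_reach a b (z.1 + 1)%R z.2.
  exists p; split=> //; first by rewrite lp; do 2!eexists.
  rewrite lp => z' kz'; rewrite /z kz' /= /diamond /robots /= addrK.
  by rewrite -surjective_pairing mem_head.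
have Ixy : I (diamond x y) by exists x, y.
have [s [s0 s_step s_hit]] := covering_sequence hit_reachable Ixy.
exists None, s; split=> //= [m _|z]; first exact/asboolP/s_step.
have [m hm] := s_hit (choice.pickle (z : int * int)).
by exists m => //; apply: hm; rewrite choice.pickleK.
Qed.

Theorem theorem3p3 : is_mob (cartesian_product P_infty P_infty) 4.
Proof.
split; last first.
  move=> S [gpS _]; apply: card_le_uniqP => s us sS.
  exact: general_position_grid_size gpS us sS.
exists (diamond 0%R 0%R); first exact: mobile_diamond.
exact/card_uniq_set/compass_uniq/diamond_compass.
Qed.
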